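(* Let $\zeta$ be a Liouville number. Then for every positive integer $k$: \begin{align*} \lambda_{k,1}(\zeta)&=\infty,\\ \frac{1}{k}\leq \lambda_{k,j}(\zeta)&\leq \frac{1}{j-1}, \qquad 2\leq j\leq k+1,\\ \widehat{\lambda}_{k,1}(\zeta)&=\frac{1}{k},\\ \widehat{\lambda}_{k,j}(\zeta)&=0, \qquad 2\leq j\leq k+1. \end{align*}
   Context: A real number $\zeta$ is a Liouville number if it is irrational and its irrationality exponent is infinite, i.e. for every $\eta\in\mathbb{R}$ the inequality $|\zeta-y/x|\leq x^{-\eta}$ has infinitely many solutions $(x,y)\in\mathbb{N}\times\mathbb{Z}$. For $\underline{\zeta}=(\zeta_1,\ldots,\zeta_k)\in\mathbb{R}^k$ and $1\leq j\leq k+1$, $\lambda_{k,j}(\underline{\zeta})$ (resp. $\widehat{\lambda}_{k,j}(\underline{\zeta})$) is the supremum of all $\eta\in\mathbb{R}$ such that the system $|x|\leq X$, $\max_{1\leq i\leq k}|\zeta_i x-y_i|\leq X^{-\eta}$ has at least $j$ linearly independent solutions $(x,y_1,\ldots,y_k)\in\mathbb{Z}^{k+1}$ for arbitrarily large real $X$ (resp. for all sufficiently large real $X$). For a real number $\zeta$ one writes $\lambda_{k,j}(\zeta):=\lambda_{k,j}(\zeta,\zeta^2,\ldots,\zeta^k)$ and $\widehat{\lambda}_{k,j}(\zeta):=\widehat{\lambda}_{k,j}(\zeta,\zeta^2,\ldots,\zeta^k)$. Convention: $1/0=\infty$. *)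

(* Defs.v *)
From HB Require Import structures.
From mathcomp Require Import all_boot all_order all_algebra.
From mathcomp Require Import all_classical all_reals all_analysis.
Set Implicit Arguments. Unset Strict Implicit. Unset Printing Implicit Defensive.
Import Order.TTheory GRing.Theory Num.Theory.
Local Open Scope classical_set_scope.
Local Open Scope ring_scope.

Definition liouville (R : realType) (zeta : R) : Prop :=
  (~ exists q : rat, zeta = ratr q) /\
  forall eta : R,
    ~ finite_set [set p : nat * int | (0 < p.1)%N /\
        `|zeta - p.2%:~R / p.1%:R| <= (p.1%:R) `^ (- eta)].

(* A vector v in Z^(k+1) = (x, y_1, ..., y_k), with x = v ord0 and
   y_(i+1) = v (lift ord0 i); the system |x| <= X, max_i |zeta_i x - y_i| <= X^-eta. *)
Definition sol_ok (R : realType) (k : nat) (z : 'I_k -> R) (X eta : R)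
  (v : 'I_k.+1 -> int) : Prop :=
  `|(v ord0)%:~R : R| <= X /\
  forall i : 'I_k, `|z i * (v ord0)%:~R - (v (lift ord0 i))%:~R| <= X `^ (- eta).

Definition has_indep_sols (R : realType) (k : nat) (z : 'I_k -> R) (j : nat)
  (X eta : R) : Prop :=
  exists V : 'M[int]_(j, k.+1),
    row_free (map_mx (fun t : int => (t%:~R : R)) V) /\
    forall r : 'I_j, sol_ok z X eta (fun c => V r c).

Definition lambda_vec (R : realType) (k : nat) (z : 'I_k -> R) (j : nat) : \bar R :=
  ereal_sup ((fun e : R => e%:E) @`
    [set eta : R | forall X0 : R, exists X : R, X0 <= X /\ has_indep_sols z j X eta]).

Definition lambda_hat_vec (R : realType) (k : nat) (z : 'I_k -> R) (j : nat) : \bar R :=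
  ereal_sup ((fun e : R => e%:E) @`
    [set eta : R | exists X0 : R, forall X : R, X0 <= X -> has_indep_sols z j X eta]).

Definition veronese {R : realType} (k : nat) (zeta : R) : 'I_k -> R :=
  fun i => zeta ^+ (i.+1).

Definition lambda {R : realType} (k j : nat) (zeta : R) : \bar R :=
  @lambda_vec R k (@veronese R k zeta) j.
Definition lambda_hat {R : realType} (k j : nat) (zeta : R) : \bar R :=
  @lambda_hat_vec R k (@veronese R k zeta) j.

(* Main.v *)
Require Import Defs.
From HB Require Import structures.
From mathcomp Require Import all_boot all_order all_algebra.
From mathcomp Require Import all_classical all_reals all_analysis.
From mathcomp Require Import perm ring lra zify.
Import Order.TTheory GRing.Theory Num.Theory.
Local Open Scope ring_scope.

(** A Liouville number admits coprime pairs (q, p) with q large and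
    |zeta - p/q| <= q^-N, for any N fixed in advance.

    - The vector (q^k, q^(k-1) p, ..., p^k) gives lambda_(k,1) = oo.  It extends
      to k+1 vectors v_0, ..., v_k, dual to the forms p y_(i-1) - q y_i in the
      sense that the i-th form takes on v_m the value 1 if i = m and 0 otherwise.
      They can be chosen with |x| <= q^k, and then their errors are O(1/q);
      hence lambda_(k,k+1) >= 1/k.
    - j independent solutions have a nonzero integer j x j minor, which is
      O(X X^(-eta (j-1))); hence lambda_(k,j) <= 1/(j-1).
    - At the scale X = q^M / 2 with M eta > 1, the same forms are integers of
      absolute value less than 1 on every solution, so every solution is
      proportional to (q^k, q^(k-1) p, ..., p^k).  There are thus no two
      independent solutions, and for M = k no nonzero solution at all.
    - Dirichlet's theorem and, for eta = 0, the vectors (1, floor z_i) and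
      (0, e_i) give the lower bounds for the uniform exponents. *)

Set Implicit Arguments.
Unset Strict Implicit.
Unset Printing Implicit Defensive.

(** * Auxiliary facts on rank, powers, suprema and determinants *)

Lemma row_free_rowsub (F : fieldType) (m n p : nat) (f : 'I_p -> 'I_m)
  (A : 'M[F]_(m, n)) : injective f -> row_free A -> row_free (rowsub f A).
Proof.
move=> fI A_free; rewrite rowsubE /row_free mxrankMfree //.
apply/row_freeP; exists (rowsub f 1%:M)^T; apply/matrixP => a b.
rewrite !mxE (bigD1 (f a)) //= big1 => [|c /negPf ca]; last first.
  by rewrite !mxE eq_sym ca mul0r.
by rewrite !mxE eqxx mul1r addr0 eq_sym (inj_eq fI).
Qed.

Lemma has_indep_sols_le (R : realType) (k : nat) (z : 'I_k -> R) (i j : nat)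
  (X eta : R) :
  (i <= j)%N -> has_indep_sols z j X eta -> has_indep_sols z i X eta.
Proof.
move=> le_ij [V [V_free V_sol]]; exists (rowsub (widen_ord le_ij) V); split.
  rewrite map_mxsub; apply: row_free_rowsub V_free.
  by move=> a b /(congr1 val) /= /val_inj.
move=> r; have := V_sol (widen_ord le_ij r); rewrite /sol_ok.
by under [X in _ -> _ /\ X]eq_forall => c do rewrite !mxE; rewrite !mxE.
Qed.

Lemma expr_dist_le (R : realFieldType) (A x y : R) (n : nat) :
  1 <= A -> `|x| <= A -> `|y| <= A ->
  `|x ^+ n - y ^+ n| <= n%:R * A ^+ n * `|x - y|.
Proof.
move=> A1 xA yA; have A0 : 0 <= A by lra.
elim: n => [|n IH]; first by rewrite !expr0 subrr normr0 !mul0r.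
have -> : x ^+ n.+1 - y ^+ n.+1 = x * (x ^+ n - y ^+ n) + (x - y) * y ^+ n.
  by rewrite !exprS; ring.
apply: le_trans (ler_normD _ _) _; rewrite !normrM normrX.
have h1 : `|x| * `|x ^+ n - y ^+ n| <= A * (n%:R * A ^+ n * `|x - y|).
  by apply: ler_pM.
have h2 : `|x - y| * `|y| ^+ n <= A * (A ^+ n * `|x - y|).
  rewrite mulrC; apply: (@le_trans _ _ (A ^+ n * `|x - y|)).
    by apply: ler_wpM2r => //; apply: lerXn2r; rewrite ?nnegrE.
  by apply: ler_peMl => //; apply: mulr_ge0 => //; apply: exprn_ge0.
apply: le_trans (lerD h1 h2) _; rewrite exprS -natr1.
by rewrite le_eqVlt; apply/orP; left; apply/eqP; ring.
Qed.

Lemma powR_gt_near (R : realType) (s D : R) :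
  0 < s -> exists B : R, forall t, B <= t -> D < t `^ s.
Proof.
move=> s0; exists ((`|D| + 1) `^ s^-1) => t Bt.
have D1 : 0 < `|D| + 1 by rewrite ltr_pwDr.
apply: (@lt_le_trans _ _ (`|D| + 1)).
  by apply: (le_lt_trans (ler_norm _)); rewrite ltrDl.
have -> : `|D| + 1 = ((`|D| + 1) `^ s^-1) `^ s.
  by rewrite -powRrM mulVf ?gt_eqF // powRr1 // ltW.
apply: ge0_ler_powR => //; rewrite ?nnegrE ?powR_ge0 // ?(ltW s0) //.
exact: le_trans (powR_ge0 _ _) Bt.
Qed.

Lemma lee_ereal_sup_EFin (R : realType) (S : set R) (a : R) :
  (forall e, e < a -> S e) -> (a%:E <= ereal_sup ((fun e : R => e%:E) @` S))%E.
Proof.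
move=> Sa; apply/lee_addgt0Pr => e e0; rewrite -leeBlDr // -EFinB.
by apply: ereal_sup_ubound; exists (a - e) => //; apply: Sa; lra.
Qed.

Lemma ereal_sup_EFin_le (R : realType) (S : set R) (a : R) :
  (forall e, S e -> e <= a) -> (ereal_sup ((fun e : R => e%:E) @` S) <= a%:E)%E.
Proof. by move=> Sa; apply: ge_ereal_sup => _ [e Se <-]; rewrite lee_fin Sa. Qed.

(** In the Leibniz expansion each of the n! terms has the same bound, because the product of the
    column weights is invariant under permutation. *)
Lemma det_le (R : realFieldType) (n : nat) (B : 'M[R]_n) (a b : 'I_n -> R) :
  (forall i j, `|B i j| <= a i * b j) ->
  `|\det B| <= n`!%:R * ((\prod_i a i) * \prod_i b i).
Proof.
move=> hB; rewrite /determinant; apply: le_trans (ler_norm_sum _ _ _) _.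
have -> : n`!%:R * ((\prod_i a i) * \prod_i b i) =
    \sum_(s : 'S_n) ((\prod_i a i) * \prod_i b i).
  by rewrite sumr_const card_Sn -[RHS]mulr_natl.
apply: ler_sum => s _; rewrite normrM normrX normrN1 expr1n mul1r normr_prod.
rewrite [X in _ * X](reindex_inj (@perm_inj _ s)) -big_split /=.
by apply: ler_prod => i _; rewrite normr_ge0 hB.
Qed.

(** * Coprime approximations to a Liouville number *)

Lemma finite_int_ball (m : nat) : finite_set [set y : int | (`|y| < m)%N].
Proof.
have : finite_set ((Posz @` `I_m) `|` ((fun n : nat => - n%:Z) @` `I_m))%classic.
  by rewrite finite_setU; split; apply: finite_image; apply: finite_II.
apply: sub_finite_set => -[n|n] /= hn; first by left; exists n.
by right; exists n.+1; rewrite // NegzE.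
Qed.

(** The integers nearest to K zeta are its floor f and f + 1, and neither equals K zeta, as zeta is
    irrational. *)
Lemma irrational_dist_gt0 (R : realType) (zeta : R) (K : nat) :
  (~ exists q : rat, zeta = ratr q) -> (0 < K)%N ->
  exists2 d : R, 0 < d & forall n : int, d <= `|K%:R * zeta - n%:~R|.
Proof.
move=> irr K0; set t := K%:R * zeta.
have tn (n : int) : n%:~R != t.
  apply/eqP => nt; apply: irr; exists (n%:~R / K%:R).
  by rewrite fmorph_div /= ratr_int ratr_nat nt mulrAC divff ?mul1r // pnatr_eq0 -lt0n.
have /andP[fl1 fl2] := floor_itv t; set f := Num.floor t in fl1 fl2 *.
have f1 : f%:~R < t by rewrite lt_neqAle tn.
rewrite rmorphD /= in fl2.
exists (Num.min (t - f%:~R) (f%:~R + 1 - t)).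
  by rewrite lt_min; apply/andP; split; lra.
move=> n; rewrite ge_min; apply/orP.
have [nf|fn] := lerP n f; [left|right].
  have : (n%:~R : R) <= f%:~R by rewrite ler_int.
  by move=> ?; apply: le_trans (ler_norm _); lra.
have : (f + 1)%:~R <= (n%:~R : R) by rewrite ler_int lezD1.
rewrite rmorphD /= -normrN => ?; apply: le_trans (ler_norm _); lra.
Qed.

(** Since q <= x, a bound x^-N on the approximation error is inherited by the reduced pair as
    q^-N. *)
Lemma reduce_fraction (R : realType) (x : nat) (y : int) : (0 < x)%N ->
  exists (q : nat) (p : int), [/\ (0 < q)%N, coprimez p q, (q <= x)%N &
    y%:~R / x%:R = p%:~R / q%:R :> R].
Proof.
move=> x0; set r : rat := y%:~R / x%:R; exists `|denq r|%N, (numq r).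
have q0 : (0 < `|denq r|)%N by rewrite absz_gt0 denq_neq0.
have rE : y%:~R / x%:R = (numq r)%:~R / (`|denq r|%N)%:R :> R.
  rewrite -[(`|denq r|%N)%:R]/((`|denq r|%N : int)%:~R) absz_denq.
  by have := congr1 (@ratr R) (divq_num_den r); rewrite !fmorph_div /= !ratr_int ratr_nat.
split => //; first exact: coprime_num_den.
have : (y * `|denq r|%N)%:~R = (numq r * x)%:~R :> R.
  rewrite !rmorphM /=; apply/eqP; rewrite -eqr_div; first by apply/eqP; exact: rE.
    by rewrite pnatr_eq0 -lt0n.
  by rewrite pnatr_eq0 -lt0n.
move/intr_inj => E.
have : (`|denq r|%N %| numq r * x)%Z by rewrite -E dvdz_mull.
rewrite Gauss_dvdzr; last by rewrite coprimez_sym; exact: coprime_num_den.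
by move=> d; apply: dvdn_leq.
Qed.

(** Distinct pairs (x, y) may represent the same fraction, so infinitely many pairs do not at once
    give large reduced denominators. But if every reduced q stays below B, then q divides the fixed
    factorial K, and K |zeta - y/x| is the distance from K zeta to an integer, hence at least some d
    > 0. This bounds x, and only finitely many pairs remain. *)
Lemma liouville_coprime_approx (R : realType) (zeta : R) (N : nat) (B : R) :
  liouville zeta ->
  exists (q : nat) (p : int), [/\ (0 < q)%N, coprimez p q, B <= q%:R &
    `|zeta - p%:~R / q%:R| <= (q%:R ^+ N)^-1].
Proof.
(* The exponent N + 1 gives an error of at most 1/x even when N = 0; this is what bounds x by
   K/d. *)
move=> [irr approx]; apply: contrapT => no_approx; apply: (approx N.+1%:R).
set K := ((Num.truncn B).+1)`!%N.
have K0 : (0 < K)%N by exact: fact_gt0.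
have KR0 : 0 < K%:R :> R by rewrite ltr0n.
have [d d0 hd] := irrational_dist_gt0 irr K0.
set C : R := K%:R / d.
have C0 : 0 < C by apply: divr_gt0.
(* The pairs lie in the box x <= C, |y| <= (|zeta| + 1) C. *)
apply: (@sub_finite_set _ _ (`I_(Num.truncn C).+1 `*`
  [set y : int | (`|y| < (Num.truncn ((`|zeta| + 1) * C)).+1)%N])%classic); last first.
  by apply: finite_setX; [exact: finite_II | exact: finite_int_ball].
move=> [x y] /= [x0].
have xR1 : 1 <= x%:R :> R by rewrite ler1n.
have xR0 : 0 < x%:R :> R by rewrite ltr0n.
rewrite powRN powR_mulrn // => hxy.
have [q [p [q0 pq qx yxE]]] := reduce_fraction R y x0.
have qR0 : 0 < q%:R :> R by rewrite ltr0n.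
have qB : q%:R < B.
  rewrite ltNge; apply/negP => Bq; apply: no_approx; exists q, p; split => //.
  rewrite -yxE; apply: le_trans hxy _.
  rewrite lef_pV2 ?posrE ?exprn_gt0 //.
  apply: (@le_trans _ _ (x%:R ^+ N)); last by apply: ler_weXn2l.
  by apply: lerXn2r; rewrite ?nnegrE ?ler0n // ler_nat.
have qK : (q %| K)%N.
  apply: dvdn_fact; rewrite q0 /= -(@ler_nat R).
  by apply: ltW; apply: (lt_trans qB); apply: truncnS_gt.
have xV : (x%:R ^+ N.+1)^-1 <= x%:R^-1 :> R.
  rewrite lef_pV2 ?posrE ?exprn_gt0 // -[X in X <= _]expr1.
  by rewrite ler_weXn2l.
have xC : x%:R <= C.
  have [c Kc] := dvdnP qK.
  have := hd (p * c%:Z); rewrite rmorphM /=.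
  have -> : K%:R * zeta - p%:~R * c%:R = K%:R * (zeta - p%:~R / q%:R).
    rewrite Kc natrM mulrBr; congr (_ - _); field; exact: lt0r_neq0.
  rewrite normrM normr_nat -yxE => dle.
  rewrite /C ler_pdivlMr // mulrC -ler_pdivlMr //.
  apply: le_trans dle _; apply: ler_wpM2l; first exact: ltW.
  exact: le_trans hxy xV.
split; first by rewrite -(@ltr_nat R); apply: (le_lt_trans xC); apply: truncnS_gt.
rewrite -(@ltr_nat R); apply: le_lt_trans (truncnS_gt _).
rewrite natr_absz intr_norm.
have -> : (y%:~R : R) = (y%:~R / x%:R) * x%:R by field; exact: lt0r_neq0.
rewrite normrM normr_nat; apply: ler_pM => //.
have -> : y%:~R / x%:R = zeta - (zeta - y%:~R / x%:R) by ring.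
apply: (le_trans (ler_normB _ _)); rewrite lerD2l.
apply: (le_trans hxy); apply: (le_trans xV).
by rewrite invf_le1.
Qed.

(** * Integer minors of solution matrices and the upper bound 1/(j-1) *)

Definition homog (R : realType) (k : nat) (z : 'I_k -> R) (c : 'I_k.+1) : R :=
  if unlift ord0 c is Some i then z i else 1.

Lemma homog_veronese (R : realType) (k : nat) (zeta : R) (c : 'I_k.+1) :
  homog (veronese zeta) c = zeta ^+ c.
Proof.
by rewrite /homog /veronese; case: unliftP => [i|] -> /=; rewrite ?expr0.
Qed.

(** The coordinate of index 0 has error 0, so it may join the others; all columns can then be
    treated alike in a minor. *)
Lemma sol_okP (R : realType) (k : nat) (z : 'I_k -> R) (X eta : R)
  (v : 'I_k.+1 -> int) :
  sol_ok z X eta v <-> `|(v ord0)%:~R : R| <= X /\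
    forall c, `|homog z c * (v ord0)%:~R - (v c)%:~R| <= X `^ (- eta).
Proof.
split=> -[vX hv]; split=> // c.
  rewrite /homog; case: unliftP => [i|] ->; first exact: hv.
  by rewrite mul1r subrr normr0 powR_ge0.
by have := hv (lift ord0 c); rewrite /homog liftK.
Qed.

(** Block elimination clears the first column. The border separates the rank-one part from E, so
    that their entries can be estimated independently. *)
Lemma det_rank1_update (R : comPzRingType) (n : nat) (a : 'rV[R]_n)
  (x : 'cV[R]_n) (E : 'M[R]_n) :
  \det (block_mx (1%:M : 'M[R]_1) a x E) = \det (E - x *m a).
Proof.
have -> : block_mx (1%:M : 'M[R]_1) a x E =
    block_mx 1%:M 0 x 1%:M *m block_mx 1%:M a 0 (E - x *m a).
  by rewrite mulmx_block !mul1mx !mul0mx !mulmx1 !addr0 addrC subrK.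
by rewrite det_mulmx det_lblock det_ublock !det1 !mul1r.
Qed.

(** After bordering, the size X occurs in a single column. With row weights A, delta, ..., delta and
    column weights X/delta, 1, ..., 1, each entry is at most the product of its two weights; for the
    corner entry 1 this uses 1 <= A and delta <= X. *)
Lemma det_rank1_update_le (R : realFieldType) (n : nat) (a : 'rV[R]_n)
  (x : 'cV[R]_n) (E : 'M[R]_n) (A X delta : R) :
  1 <= A -> 0 < delta <= X -> (forall c, `|a 0 c| <= A) ->
  (forall r, `|x r 0| <= X) -> (forall r c, `|E r c| <= delta) ->
  `|\det (E - x *m a)| <= n.+1`!%:R * (A * delta ^+ n * (X / delta)).
Proof.
move=> A1 /andP[d0 dX] hA hX hE; rewrite -det_rank1_update.
pose al (i : 'I_(1 + n)) := if fintype.split i is inl _ then A else delta.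
pose be (i : 'I_(1 + n)) := if fintype.split i is inl _ then X / delta else 1.
have al_l i : al (lshift n i) = A by rewrite /al (unsplitK (inl i)).
have al_r i : al (rshift 1 i) = delta by rewrite /al (unsplitK (inr i)).
have be_l i : be (lshift n i) = X / delta by rewrite /be (unsplitK (inl i)).
have be_r i : be (rshift 1 i) = 1 by rewrite /be (unsplitK (inr i)).
have -> : A * delta ^+ n * (X / delta) = (\prod_i al i) * \prod_i be i.
  rewrite !big_split_ord /= !big_ord1 al_l be_l.
  under eq_bigr do rewrite al_r.
  under [X in _ = _ * (_ * X)]eq_bigr do rewrite be_r.
  by rewrite big1_eq prodr_const card_ord mulr1.
apply: det_le => i j.
have [i' ->|i' ->] := split_ordP i; have [j' ->|j' ->] := split_ordP j.
- rewrite block_mxEul al_l be_l !ord1 mxE eqxx mulr1n normr1.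
  rewrite -[leLHS]mulr1; apply: ler_pM => //.
  by rewrite ler_pdivlMr // mul1r.
- by rewrite block_mxEur al_l be_r !ord1 mulr1.
- by rewrite block_mxEdl al_r be_l !ord1 mulrC divfK ?gt_eqF.
- by rewrite block_mxEdr al_r be_r mulr1.
Qed.

(* Up to sign, a nonzero maximal minor of the solution matrix is the determinant
   of the error matrix plus a rank-one matrix of size X; being a nonzero integer,
   it is at least 1 in absolute value. *)
Lemma has_indep_sols_bound (R : realType) (k j : nat) (z : 'I_k -> R) :
  exists C : R, forall X eta : R, 1 <= X -> 0 <= eta ->
    has_indep_sols z j.+1 X eta -> 1 <= C * (X * (X `^ (- eta)) ^+ j).
Proof.
pose A : R := 1 + \sum_i `|z i|.
have s0 : 0 <= \sum_i `|z i| by apply: sumr_ge0.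
have A1 : 1 <= A by rewrite lerDl.
have hA c : `|homog z c| <= A.
  rewrite /homog; case: unlift => [i|]; last by rewrite normr1.
  rewrite /A (bigD1 i) //= addrCA lerDl addr_ge0 //.
  by apply: sumr_ge0.
(* The minor has size j + 1 and its bordered form size j + 2, whence the factorial. *)
exists (j.+2`!%:R * A) => X eta X1 eta0 [V [V_free V_sol]].
set delta := X `^ (- eta).
have X0 : 0 < X by apply: lt_le_trans X1.
have d0 : 0 < delta by apply: powR_gt0.
have d1 : delta <= 1 by rewrite -(powRr0 X); apply: ler_powR; rewrite ?oppr_le0.
have V_full : row_full (map_mx (fun t : int => (t%:~R : R)) V)^T.
  by rewrite /row_full mxrank_tr.
(* [f] selects j + 1 columns carrying a nonzero minor. *)
pose f := fullrankfun V_full.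
pose M := colsub f V.
have detM : \det M != 0.
  have := fullrowsub_unit V_full; rewrite -/f unitmxE unitfE -det_tr.
  have -> : (rowsub f (map_mx (fun t : int => (t%:~R : R)) V)^T)^T =
      map_mx intr M by apply/matrixP => r c; rewrite !mxE.
  by rewrite det_map_mx intr_eq0.
pose a : 'rV[R]_j.+1 := \row_c homog z (f c).
pose x : 'cV[R]_j.+1 := \col_r (V r ord0)%:~R.
pose E : 'M[R]_j.+1 := \matrix_(r, c) (a 0 c * x r 0 - (M r c)%:~R).
have EM : E - x *m a = - map_mx intr M.
  apply/matrixP => r c; rewrite !mxE big_ord1 !mxE; ring.
have := @det_rank1_update_le _ _ a x E A X delta A1.
rewrite EM -scaleN1r detZ normrM normrX normrN1 expr1n mul1r det_map_mx /=.
have -> : A * delta ^+ j.+1 * (X / delta) = A * (X * delta ^+ j).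
  by rewrite exprS; field; rewrite gt_eqF.
rewrite -intr_norm -mulrA => bound; apply: le_trans (bound _ _ _ _).
- by rewrite ler1z -gtz0_ge1 normr_gt0.
- by rewrite d0 (le_trans d1).
- by move=> c; rewrite mxE.
- by move=> r; rewrite mxE; have /sol_okP[] := V_sol r.
- by move=> r c; rewrite !mxE; have /sol_okP[_] := V_sol r; apply.
Qed.

(** For eta > 1/j the quantity X^(1 - j eta) tends to 0, against the lower bound 1 for its product
    with the constant C. *)
Lemma lambda_vec_le (R : realType) (k j : nat) (z : 'I_k -> R) : (0 < j)%N ->
  (lambda_vec z j.+1 <= (j%:R^-1)%:E)%E.
Proof.
move=> j0; apply: ereal_sup_EFin_le => eta heta; rewrite leNgt; apply/negP => lt_eta.
have jR0 : 0 < j%:R :> R by rewrite ltr0n.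
have eta0 : 0 < eta by apply: lt_trans lt_eta; rewrite invr_gt0.
have s0 : 0 < j%:R * eta - 1 by rewrite subr_gt0 -ltr_pdivrMl // mulr1.
have [C hC] := has_indep_sols_bound j z.
have [B hB] := powR_gt_near C s0.
have [X [BX /hC]] := heta (Num.max B 1).
rewrite ge_max in BX; case/andP: BX => BX X1 /(_ X1 (ltW eta0)).
have X0 : 0 < X by apply: lt_le_trans X1.
rewrite leNgt => /negP; apply.
have -> : X * (X `^ (- eta)) ^+ j = (X `^ (j%:R * eta - 1))^-1.
  rewrite -powR_mulrn ?powR_ge0 // -powRrM -{1}(powRr1 (ltW X0)) -powRD; last first.
    by apply/implyP => _; rewrite gt_eqF.
  by rewrite -powRN; congr (_ `^ _); ring.
by rewrite ltr_pdivrMr ?powR_gt0 // mul1r; apply: hB.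
Qed.

(** * Rigidity of solutions and upper bounds for the uniform exponents *)

Lemma int_norm_lt1 (R : realType) (n : int) : `|n%:~R : R| < 1 -> n = 0.
Proof.
rewrite -intr_norm -[1]/(1%:~R) ltr_int => n1; apply/eqP; rewrite -normr_le0; lia.
Qed.

Lemma approx_norm_le (R : realType) (zeta : R) (q : nat) (p : int) (N : nat) :
  (0 < q)%N -> `|zeta - p%:~R / q%:R| <= (q%:R ^+ N)^-1 ->
  `|p%:~R / q%:R| <= `|zeta| + 1.
Proof.
move=> q0 h; have -> : p%:~R / q%:R = zeta - (zeta - p%:~R / q%:R) by ring.
apply: (le_trans (ler_normB _ _)); rewrite lerD2l; apply: (le_trans h).
by rewrite invf_le1 ?exprn_gt0 ?ltr0n // exprn_ege1 // ler1n.
Qed.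

Lemma geometric_of_ratio (k : nat) (v : nat -> int) (p q : int) :
  (forall i, (i < k)%N -> p * v i = q * v i.+1) ->
  forall i, (i <= k)%N -> v i * q ^+ i = p ^+ i * v 0%N.
Proof.
move=> hv; elim=> [|i IH] ik; first by rewrite !expr0 mulr1 mul1r.
rewrite [in LHS]exprS mulrA [v _ * q]mulrC -hv // -mulrA IH 1?ltnW //.
by rewrite exprS mulrA.
Qed.

(* The linear forms p v_i - q v_(i+1) are integers that become smaller than 1 on
   every solution at the scale X = q^M / 2. *)
Lemma liouville_rigid (R : realType) (zeta : R) (k M : nat) (eta X0 : R) :
  liouville zeta -> 0 < eta -> 1 < M%:R * eta ->
  exists (X : R) (q : nat) (p : int),
  [/\ X0 <= X, (0 < q)%N, coprimez p q, X < q%:R ^+ M &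
      forall v : 'I_k.+1 -> int, sol_ok (veronese zeta) X eta v ->
      forall c, v c * q%:Z ^+ c = p ^+ c * v ord0].
Proof.
move=> Hz eta0 Meta; set A := `|zeta| + 1.
have A1 : 1 <= A by rewrite lerDr.
have A0 : 0 < A by apply: lt_le_trans A1.
have s0 : 0 < M%:R * eta - 1 by rewrite subr_gt0.
have [B hB] := powR_gt_near (4 * A * 2 `^ eta) s0.
(* The precision M + 2 leaves a factor 1/(2q) in the term containing zeta - p/q, and q > A^k then
   makes that term less than 1/2. The bound [B] does the same for the solution errors, and q >= 2 X0
   ensures X >= X0. *)
have [q [p [q0 pq]]] := liouville_coprime_approx M.+2
  (Num.max B (Num.max (2 * X0) (A ^+ k + 1))) Hz.
rewrite !ge_max => /and3P[qB qX qA] happ.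
have pA := approx_norm_le q0 happ.
have q1 : 1 <= q%:R :> R by rewrite ler1n.
have qR0 : 0 < q%:R :> R by rewrite ltr0n.
have qM0 : 0 < q%:R ^+ M :> R by apply: exprn_gt0.
have M0 : (0 < M)%N by rewrite lt0n; apply/eqP => M0; move: Meta; rewrite M0 mul0r; lra.
have qM : q%:R <= q%:R ^+ M :> R by rewrite -[leLHS]expr1; apply: ler_weXn2l.
exists (q%:R ^+ M / 2), q, p; set X := q%:R ^+ M / 2.
have X_gt0 : 0 < X by rewrite divr_gt0.
split => //; [by rewrite /X; lra | by rewrite /X; lra |].
move=> v /sol_okP[vX hv] c.
set delta := X `^ (- eta) in hv.
have d0 : 0 < delta by apply: powR_gt0.
set s := M%:R * eta - 1 in s0 hB.
have qs0 : 0 < q%:R `^ s by apply: powR_gt0.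
have qdelta : q%:R * delta = 2 `^ eta / q%:R `^ s.
  have E : X `^ eta * 2 `^ eta = q%:R * q%:R `^ s.
    rewrite -powRM // 1?ltW // /X divfK // -powR_mulrn // -powRrM.
    rewrite -{2}(powRr1 (ltW qR0)) -powRD; last by apply/implyP => _; rewrite gt_eqF.
    by congr (_ `^ _); rewrite /s; ring.
  have -> : 2 `^ eta = q%:R * q%:R `^ s / X `^ eta by rewrite -E mulrC mulKf // gt_eqF // powR_gt0.
  rewrite /delta powRN; field; rewrite !gt_eqF ?powR_gt0 //.
have small : 2 * A * (q%:R * delta) < 2^-1.
  rewrite qdelta mulrA ltr_pdivrMr //.
  by have := hB _ qB; lra.
pose w i := v (inord i).
have wE : forall c : 'I_k.+1, v c = w c by move=> d; rewrite /w inord_val.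
have w0 : w 0%N = v ord0 by rewrite (wE ord0).
rewrite wE -w0; apply: (@geometric_of_ratio k); last by rewrite -ltnS.
move=> i ik; apply/eqP; rewrite -subr_eq0; apply/eqP; apply: (@int_norm_lt1 R).
have {}hv j : (j <= k)%N -> `|zeta ^+ j * (w 0%N)%:~R - (w j)%:~R| <= delta.
  by move=> jk; have := hv (inord j); rewrite homog_veronese inordK // -w0.
rewrite rmorphB !rmorphM /= -[(q%:~R : R)]/(q%:R : R).
set x := (w 0%N)%:~R in hv *; set wi := (w i)%:~R; set wj := (w i.+1)%:~R.
have xX : `|x| <= X by rewrite /x w0.
(* The first summand measures how far zeta is from p/q, the rest collects the errors of the
   solution; each part contributes less than 1/2. *)
have -> : p%:~R * wi - q%:R * wj =
    zeta ^+ i * x * (q%:R * (p%:~R / q%:R - zeta)) -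
    (q%:R * (p%:~R / q%:R) * (zeta ^+ i * x - wi) -
    q%:R * (zeta ^+ i.+1 * x - wj)).
  by rewrite exprS; field; rewrite gt_eqF.
apply: (le_lt_trans (ler_normB _ _)).
have b1 : `|zeta ^+ i * x * (q%:R * (p%:~R / q%:R - zeta))| < 2^-1.
  rewrite !normrM normr_nat normrX distrC.
  have h1 : `|zeta| ^+ i <= A ^+ k.
    apply: (@le_trans _ _ (A ^+ i)); last by apply: ler_weXn2l => //; apply: ltnW.
    by apply: lerXn2r; rewrite ?nnegrE ?(ltW A0) // lerDl.
  apply: (@le_lt_trans _ _ (A ^+ k * X * (q%:R * (q%:R ^+ M.+2)^-1))).
    apply: ler_pM; rewrite ?mulr_ge0 ?exprn_ge0 //; first exact: ler_pM.
    by apply: ler_wpM2l.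
  have -> : A ^+ k * X * (q%:R * (q%:R ^+ M.+2)^-1) = A ^+ k / q%:R / 2.
    by rewrite /X !exprS; field; rewrite !gt_eqF.
  rewrite -[X in _ < X]mul1r ltr_pM2r ?invr_gt0 // ltr_pdivrMr // mul1r.
  by apply: lt_le_trans qA; rewrite ltrDl.
have b2 : `|q%:R * (p%:~R / q%:R) * (zeta ^+ i * x - wi) -
    q%:R * (zeta ^+ i.+1 * x - wj)| <= 2 * A * (q%:R * delta).
  apply: (le_trans (ler_normB _ _)).
  have -> : 2 * A * (q%:R * delta) = q%:R * A * delta + q%:R * (A * delta) by ring.
  apply: lerD.
    rewrite -[X in `|X|]mulrA normrM normr_nat -[leRHS]mulrA.
    apply: ler_wpM2l; first exact: ltW.
    by rewrite normrM; apply: ler_pM => //; apply: hv; apply: ltnW.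
  rewrite normrM normr_nat.
  apply: ler_wpM2l; first exact: ltW.
  by apply: (le_trans (hv _ _)) => //; apply: ler_peMl => //; apply: ltW.
lra.
Qed.

(** Rigidity with M = k and c = k gives v_k q^k = p^k v_0, so q^k divides v_0 by coprimality, while
    |v_0| <= X < q^k. Hence v_0 = 0, and then every coordinate vanishes. *)
Lemma lambda_hat1_le (R : realType) (zeta : R) (k : nat) :
  liouville zeta -> (0 < k)%N -> (lambda_hat k 1 zeta <= (k%:R^-1)%:E)%E.
Proof.
move=> Hz k0; apply: ereal_sup_EFin_le => eta [X0 heta].
rewrite leNgt; apply/negP => lt_eta.
have kR0 : 0 < k%:R :> R by rewrite ltr0n.
have eta0 : 0 < eta by apply: lt_trans lt_eta; rewrite invr_gt0.
have [|X [q [p [X0X q0 pq Xq rigid]]]] := @liouville_rigid _ zeta k k eta X0 Hz eta0.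
  by rewrite -ltr_pdivrMl // mulr1.
have [V [V_free /(_ ord0) V_sol]] := heta X X0X.
have geo := rigid _ V_sol; have [vX _] := V_sol.
have v0 : V ord0 ord0 = 0.
  have : (q%:Z ^+ k %| p ^+ k * V ord0 ord0)%Z.
    by have := geo ord_max => /= <-; rewrite dvdz_mull.
  rewrite Gauss_dvdzr; last first.
    by rewrite coprimez_sym; apply: coprimezXl; apply: coprimezXr.
  move=> /dvdzP[m vE]; move: vX; rewrite vE => vX.
  suff -> : m = 0 by rewrite mul0r.
  apply: (@int_norm_lt1 R).
  rewrite rmorphM rmorphXn /= normrM normrX normr_nat in vX.
  have qk0 : 0 < q%:R ^+ k :> R by rewrite exprn_gt0 // ltr0n.
  by rewrite -(ltr_pM2r qk0) mul1r; apply: le_lt_trans Xq.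
have V0 : V = 0.
  apply/matrixP => r c; rewrite ord1 mxE; apply/eqP.
  have := geo c; rewrite v0 mulr0 => /eqP; rewrite mulf_eq0 => /orP[//|].
  rewrite expf_eq0 => /andP[_] /eqP[] q00; by rewrite q00 in q0.
by move: V_free; rewrite V0 map_mx0 /row_free mxrank0.
Qed.

(** By rigidity the matrix of solutions is a column times the row of powers of p/q, so its rank is
    at most 1; any M > 1/eta serves. *)
Lemma lambda_hat_le0 (R : realType) (zeta : R) (k j : nat) :
  liouville zeta -> (1 < j)%N -> (lambda_hat k j zeta <= 0%:E)%E.
Proof.
move=> Hz j1; apply: ereal_sup_EFin_le => eta [X0 heta].
rewrite leNgt; apply/negP => eta0.
pose M := (Num.truncn eta^-1).+1.
have [|X [q [p [X0X q0 _ _ rigid]]]] := @liouville_rigid _ zeta k M eta X0 Hz eta0.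
  by rewrite -ltr_pdivrMr // mul1r truncnS_gt.
have [V [V_free V_sol]] := heta X X0X.
have qR : (q%:R : R) != 0 by rewrite pnatr_eq0 -lt0n.
have E : map_mx (fun t : int => (t%:~R : R)) V =
    (\col_r (V r ord0)%:~R) *m (\row_c (p%:~R / q%:R) ^+ c).
  apply/matrixP => r c; rewrite !mxE big_ord1 !mxE.
  have := congr1 (fun t : int => (t%:~R : R)) (rigid _ (V_sol r) c) => /=.
  rewrite !rmorphM !rmorphXn /= -[(q%:~R : R)]/(q%:R : R) => h.
  apply: (mulIf (expf_neq0 c qR)); rewrite h expr_div_n.
  by field; rewrite expf_neq0.
have : (\rank (map_mx (fun t : int => (t%:~R : R)) V) <= 1)%N.
  by rewrite E; apply: leq_trans (mxrankM_maxl _ _) (rank_leq_col _).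
by move: V_free => /eqP ->; lia.
Qed.

(** * Dual vectors and lower bounds for the ordinary exponents *)

Lemma bezout_small (a b : int) : coprimez a b -> 0 < b ->
  exists u t : int, u * a = 1 + t * b /\ 0 <= u < b.
Proof.
(* Reducing u modulo b and moving the quotient into t keeps u < b; this later gives v_0 <= q^k. *)
move=> /coprimezP[[u t] /= E] b0; exists (u %% b)%Z, (- t - (u %/ b)%Z * a).
split; last by rewrite modz_ge0 ?gt_eqF // ltz_pmod.
have := divz_eq u b; set w := (u %/ b)%Z; set r := (u %% b)%Z => uE.
by rewrite -E uE; ring.
Qed.

(* For m = 0 this is the vector of (p/q)^i q^k; for m > 0 it solves
   p v_i - q v_(i+1) = 0 on both sides of the single jump at i = m - 1. *)
Lemma dual_vector (k m q : nat) (p : int) :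
  (m <= k)%N -> (0 < q)%N -> coprimez p q ->
  exists v : nat -> int, [/\ 0 <= v 0%N <= q%:Z ^+ k, m = 0%N -> v 0%N != 0 &
    forall i, (i < k)%N -> p * v i - q%:Z * v i.+1 = (i.+1 == m)%:R].
Proof.
move=> mk q0 pq; have qZ : 0 < q%:Z by [].
case: m mk => [_|m mk].
  exists (fun i => p ^+ i * q%:Z ^+ (k - i)); split.
  - by rewrite expr0 mul1r subn0 lexx exprn_ge0.
  - by rewrite expr0 mul1r expf_neq0 // gt_eqF.
  - by move=> i ik; rewrite -(subnSK ik) !exprS /=; ring.
have b0 : 0 < q%:Z ^+ (k - m) by apply: exprn_gt0.
have cop : coprimez (p ^+ m.+1) (q%:Z ^+ (k - m)).
  by apply: coprimezXl; apply: coprimezXr.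
have [u [t [E /andP[u0 ub]]]] := bezout_small cop b0.
(* Both branches are geometric of ratio p/q. At i = m the form takes the value u p^(m+1) - t q^(k-m)
   = 1 by the Bezout relation. *)
exists (fun i => if (i <= m)%N then u * q%:Z ^+ (m - i) * p ^+ i
                 else t * p ^+ (i - m.+1) * q%:Z ^+ (k - i)); split => //.
  rewrite leq0n subn0 expr0 mulr1 mulr_ge0 ?exprn_ge0 //=.
  have -> : q%:Z ^+ k = q%:Z ^+ (k - m) * q%:Z ^+ m by rewrite -exprD subnK // ltnW.
  apply: ler_wpM2r; last exact: ltW.
  exact: exprn_ge0.
move=> i ik; rewrite eqSS; have [im|mi|->] := ltngtP i m.
- by rewrite -(subnSK im) !exprS /=; ring.
- by rewrite -(subnSK ik) subSn // !exprS /=; ring.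
- have -> : p * (u * q%:Z ^+ (m - m) * p ^+ m) = u * p ^+ m.+1.
    by rewrite subnn expr0 exprS; ring.
  by rewrite E subnn -(subnSK mk) exprS expr0 mulr1 /=; ring.
Qed.

(** The error obeys e_(i+1) = r e_i + b/q with r = p/q: each step multiplies by at most A and adds
    at most 1/q. *)
Lemma ratio_error_le (R : realType) (k q : nat) (p : int) (A : R) (v : nat -> int) :
  (0 < q)%N -> 1 <= A -> `|p%:~R / q%:R| <= A ->
  (forall i, (i < k)%N -> exists b : bool, p * v i - q%:Z * v i.+1 = b%:R) ->
  forall i, (i <= k)%N ->
  `|(p%:~R / q%:R) ^+ i * (v 0%N)%:~R - (v i)%:~R| <= i%:R * A ^+ i / q%:R :> R.
Proof.
move=> q0 A1 pA hv; set r := p%:~R / q%:R in pA *.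
have qR0 : 0 < q%:R :> R by rewrite ltr0n.
have A0 : 0 <= A by lra.
elim=> [|i IH] ik; first by rewrite expr0 mul1r subrr normr0 !mul0r.
have [b hb] := hv i ik.
have {}hb : p%:~R * (v i)%:~R - q%:R * (v i.+1)%:~R = b%:R :> R.
  by have := congr1 (fun t : int => (t%:~R : R)) hb; rewrite rmorphB !rmorphM /=; case: (b).
have -> : r ^+ i.+1 * (v 0%N)%:~R - (v i.+1)%:~R =
    r * (r ^+ i * (v 0%N)%:~R - (v i)%:~R) + b%:R / q%:R.
  by rewrite -hb exprS /r; field; rewrite gt_eqF.
apply: (le_trans (ler_normD _ _)); rewrite normrM [`|b%:R / _|]ger0_norm ?divr_ge0 //.
have h1 : `|r| * `|r ^+ i * (v 0%N)%:~R - (v i)%:~R| <= A * (i%:R * A ^+ i / q%:R).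
  by apply: ler_pM => //; apply: IH; apply: ltnW.
have h2 : b%:R / q%:R <= A ^+ i.+1 / q%:R :> R.
  apply: ler_wpM2r; first by rewrite invr_ge0 ltW.
  by apply: (@le_trans _ _ 1); [case: (b) | apply: exprn_ege1].
apply: le_trans (lerD h1 h2) _; rewrite exprS -natr1.
by rewrite le_eqVlt; apply/orP; left; apply/eqP; ring.
Qed.

Lemma powR_expn (R : realType) (q k : nat) (eta : R) : (0 < q)%N ->
  (q%:R ^+ k : R) `^ (- eta) = (q%:R `^ (k%:R * eta))^-1.
Proof. by move=> q0; rewrite powRN -powR_mulrn // -powRrM. Qed.

(** Passing through the rational point r separates the quality of the approximation r from the error
    of the integer vector relative to r. *)
Lemma veronese_error_le (R : realType) (zeta r x y : R) (A : R) (k i : nat) :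
  (i <= k)%N -> 1 <= A -> `|zeta| <= A -> `|r| <= A ->
  `|zeta ^+ i * x - y| <= k%:R * A ^+ k * `|zeta - r| * `|x| + `|r ^+ i * x - y|.
Proof.
move=> ik A1 zA rA.
have -> : zeta ^+ i * x - y = (zeta ^+ i - r ^+ i) * x + (r ^+ i * x - y) by ring.
apply: (le_trans (ler_normD _ _)); rewrite lerD2r normrM.
apply: ler_wpM2r => //; apply: (le_trans (expr_dist_le _ A1 zA rA)).
apply: ler_wpM2r => //; apply: ler_pM => //; rewrite ?ler_nat //.
  by apply: exprn_ge0; lra.
exact: ler_weXn2l.
Qed.

Lemma lambda1_eq (R : realType) (zeta : R) (k : nat) :
  liouville zeta -> (0 < k)%N -> lambda k 1 zeta = +oo%E.
Proof.
move=> Hz k0; apply: eq_infty => eta; apply: ereal_sup_ubound; exists eta => // X0.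
set A := `|zeta| + 1; have A1 : 1 <= A by rewrite lerDr.
set C : R := k%:R * A ^+ k.
(* As n > k eta, an error of q^-n suffices. In the precision k + n + 1, the k offsets |x| = q^k and
   the extra 1 absorbs C <= q. *)
set n := (Num.truncn (k%:R * eta)).+1.
have [q [p [q0 pq]]] := liouville_coprime_approx (k + n.+1) (Num.max X0 C) Hz.
rewrite ge_max => /andP[qX qC] happ.
have q1 : 1 <= q%:R :> R by rewrite ler1n.
have qR0 : 0 < q%:R :> R by rewrite ltr0n.
have pA := approx_norm_le q0 happ.
exists (q%:R ^+ k); split.
  by apply: (le_trans qX); rewrite -[leLHS]expr1; apply: ler_weXn2l.
exists (\row_c (p ^+ c * q%:Z ^+ (k - c))); split.
  rewrite -row_leq_rank lt0n mxrank_eq0; apply/eqP => /matrixP/(_ ord0 ord0).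
  by rewrite !mxE expr0 mul1r subn0 => /eqP; rewrite rmorphXn /= expf_eq0 gt_eqF ?andbF.
move=> r; apply/sol_okP; rewrite !mxE expr0 mul1r subn0 rmorphXn /= -[(q%:~R : R)]/(q%:R : R).
split=> [|c]; first by rewrite ger0_norm // exprn_ge0.
rewrite homog_veronese !mxE rmorphM !rmorphXn /= -[(q%:~R : R)]/(q%:R : R).
have ck : (c <= k)%N by rewrite -ltnS.
apply: (le_trans (@veronese_error_le _ _ (p%:~R / q%:R) _ _ A k c ck A1 _ pA)).
  by rewrite lerDl.
have -> : (p%:~R / q%:R) ^+ c * q%:R ^+ k - p%:~R ^+ c * q%:R ^+ (k - c) = 0 :> R.
  have -> : q%:R ^+ k = q%:R ^+ c * q%:R ^+ (k - c) :> R by rewrite -exprD subnKC.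
  rewrite expr_div_n; field.
  by rewrite expf_neq0 // gt_eqF.
rewrite normr0 addr0 powR_expn // -/C [`|q%:R ^+ k|]ger0_norm ?exprn_ge0 //.
apply: (@le_trans _ _ (C * (q%:R ^+ (k + n.+1))^-1 * q%:R ^+ k)).
  apply: ler_wpM2r; first exact: exprn_ge0.
  by apply: ler_wpM2l => //; rewrite mulr_ge0 // exprn_ge0 //; lra.
have -> : C * (q%:R ^+ (k + n.+1))^-1 * q%:R ^+ k = C / q%:R * (q%:R ^+ n)^-1.
  by rewrite exprD exprS; field; rewrite !expf_neq0 ?gt_eqF.
apply: (@le_trans _ _ (q%:R ^+ n)^-1).
  rewrite -[leRHS]mul1r; apply: ler_wpM2r; first by rewrite invr_ge0 exprn_ge0.
  by rewrite ler_pdivrMr // mul1r.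
rewrite lef_pV2 ?posrE ?exprn_gt0 ?powR_gt0 // -powR_mulrn //.
by apply: ler_powR => //; apply: ltW; apply: truncnS_gt.
Qed.

(** Applying the i-th form to a vanishing combination isolates the coefficient of the i-th dual
    vector. Only the coefficient of w_0 is left, and the nonzero coordinate [w 0 0] kills it. *)
Lemma row_free_dual_basis (R : realType) (k : nat) (w : nat -> nat -> int)
  (p q : int) : w 0%N 0%N != 0 ->
  (forall m i, (m <= k)%N -> (i < k)%N ->
     p * w m i - q * w m i.+1 = (i.+1 == m)%:R) ->
  row_free (map_mx (fun t : int => (t%:~R : R)) (\matrix_(m < k.+1, c < k.+1) w m c)).
Proof.
move=> w00 hw; apply: inj_row_free => u uV.
have uc (c : nat) : (c <= k)%N -> \sum_m u 0 m * (w m c)%:~R = 0.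
  move=> ck; have /matrixP/(_ 0 (inord c)) := uV; rewrite !mxE => E.
  by rewrite -[RHS]E; apply: eq_bigr => m _; rewrite !mxE inordK.
have u_lift (i : 'I_k) : u 0 (lift ord0 i) = 0.
  have: \sum_m u 0 m * (p * w m i - q * w m i.+1)%:~R = 0.
    transitivity (p%:~R * (\sum_m u 0 m * (w m i)%:~R) -
                  q%:~R * (\sum_m u 0 m * (w m i.+1)%:~R)).
      rewrite !mulr_sumr -sumrB; apply: eq_bigr => m _.
      by rewrite rmorphB !rmorphM /=; ring.
    by rewrite (uc _ (ltnW (ltn_ord i))) (uc _ (ltn_ord i)) !mulr0 subrr.
  rewrite (bigD1 (lift ord0 i)) //= hw // eqxx mulr1 big1 ?addr0 // => m mi.
  rewrite hw //; last by rewrite -ltnS.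
  suff /negPf -> : i.+1 != m by rewrite mulr0.
  by apply: contraNneq mi => im; apply/eqP/val_inj.
apply/matrixP => a b; rewrite ord1 mxE.
have [i ->|->] := unliftP ord0 b; first exact: u_lift.
have := uc 0%N (leq0n k); rewrite big_ord_recl big1 ?addr0 => [/eqP|i _].
  by rewrite mulf_eq0 intr_eq0 (negPf w00) orbF => /eqP.
by rewrite u_lift mul0r.
Qed.

Lemma lambda_ge (R : realType) (zeta : R) (k j : nat) :
  liouville zeta -> (0 < k)%N -> (j <= k.+1)%N ->
  ((k%:R^-1)%:E <= lambda k j zeta)%E.
Proof.
move=> Hz k0 jk; apply: lee_ereal_sup_EFin => eta eta_lt X0.
have kR0 : 0 < k%:R :> R by rewrite ltr0n.
set A := `|zeta| + 1; have A1 : 1 <= A by rewrite lerDr.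
set C : R := k%:R * A ^+ k.
(* With precision k + 1 and |x| <= q^k the total error is at most 2C/q. It must not exceed
   (q^k)^(-eta), hence the demand 2C < q^(1 - k eta). *)
have s0 : 0 < 1 - k%:R * eta by rewrite subr_gt0 -ltr_pdivlMl // mulr1.
have [B hB] := powR_gt_near (2 * C) s0.
have [q [p [q0 pq]]] := liouville_coprime_approx k.+1 (Num.max X0 B) Hz.
rewrite ge_max => /andP[qX /hB {}hB] happ.
have q1 : 1 <= q%:R :> R by rewrite ler1n.
have qR0 : 0 < q%:R :> R by rewrite ltr0n.
have qk0 : 0 < q%:R ^+ k :> R by apply: exprn_gt0.
have pA := approx_norm_le q0 happ.
exists (q%:R ^+ k); split.
  by apply: (le_trans qX); rewrite -[leLHS]expr1; apply: ler_weXn2l.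
apply: (has_indep_sols_le jk).
have /choice[w hw] : forall m : nat, exists v : nat -> int, (m <= k)%N ->
    [/\ 0 <= v 0%N <= q%:Z ^+ k, m = 0%N -> v 0%N != 0 &
    forall i, (i < k)%N -> p * v i - q%:Z * v i.+1 = (i.+1 == m)%:R].
  move=> m; have [mk|mk] := leqP m k; last by exists (fun=> 0).
  by have [v hv] := dual_vector mk q0 pq; exists v.
exists (\matrix_(m < k.+1, c < k.+1) w m c); split.
  apply: (@row_free_dual_basis _ k w p q%:Z); first by have [] := hw 0%N (leq0n k); auto.
  by move=> m i /hw[_ _]; apply.
move=> m; have mk : (m <= k)%N by rewrite -ltnS.
have [/andP[w0 wq] _ hwm] := hw m mk.
have wmq : `|(w m 0%N)%:~R| <= q%:R ^+ k :> R.
  by rewrite ger0_norm ?ler0z // -[q%:R]/(q%:~R) -rmorphXn ler_int.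
apply/sol_okP; rewrite !mxE; split => // c.
rewrite homog_veronese !mxE.
have ck : (c <= k)%N by rewrite -ltnS.
apply: (le_trans (@veronese_error_le _ _ (p%:~R / q%:R) _ _ A k c ck A1 _ pA)).
  by rewrite lerDl.
have AC : c%:R * A ^+ c <= C.
  apply: ler_pM; rewrite ?ler_nat //; first by apply: exprn_ge0; lra.
  exact: ler_weXn2l.
have h2 : `|(p%:~R / q%:R) ^+ c * (w m 0%N)%:~R - (w m c)%:~R| <= C / q%:R.
  apply: (@le_trans _ _ (c%:R * A ^+ c / q%:R)); last first.
    by apply: ler_wpM2r => //; rewrite invr_ge0 ltW.
  apply: (@ratio_error_le _ k) => // i ik; exists (i.+1 == m :> nat); exact: hwm.
have h1 : C * `|zeta - p%:~R / q%:R| * `|(w m 0%N)%:~R| <= C / q%:R.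
  have -> : C / q%:R = C * (q%:R ^+ k.+1)^-1 * q%:R ^+ k.
    by rewrite exprS; field; rewrite !gt_eqF.
  have C0 : 0 <= C by rewrite mulr_ge0 // exprn_ge0 //; lra.
  by apply: ler_pM => //; [exact: mulr_ge0 | apply: ler_wpM2l].
apply: le_trans (lerD h1 h2) _; rewrite powR_expn //.
rewrite -mulrDl ler_pdivrMr // -ler_pdivrMl ?invr_gt0 ?powR_gt0 // invrK.
have -> : q%:R `^ (k%:R * eta) * (C + C) = 2 * C * q%:R `^ (k%:R * eta) by ring.
rewrite -ler_pdivlMr ?powR_gt0 //.
have -> : q%:R / q%:R `^ (k%:R * eta) = q%:R `^ (1 - k%:R * eta).
  by rewrite powRB ?powRr1 //; apply/implyP => _; rewrite gt_eqF.
exact: ltW.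
Qed.

(** * Lower bounds for the uniform exponents, valid for every vector z *)

Lemma dirichlet_simultaneous (R : realType) (k N : nat) (z : 'I_k -> R) :
  (0 < N)%N -> exists (x : nat) (y : 'I_k -> int),
  (0 < x <= N ^ k)%N /\ forall i, `|z i * x%:R - (y i)%:~R| <= N%:R^-1.
Proof.
case: N => // n _; set N := n.+1.
have NR0 : 0 < N%:R :> R by rewrite ltr0n.
pose fl (a : nat) i := Num.floor (z i * a%:R).
pose fr (a : nat) i := z i * a%:R - (fl a i)%:~R.
have fr01 a i : 0 <= fr a i < 1.
  have /andP[] := floor_itv (z i * a%:R); rewrite rmorphD /= /fr /fl => ? ?.
  by apply/andP; split; lra.
have trN a i : (Num.truncn (N%:R * fr a i) < N)%N.
  have /andP[f0 f1] := fr01 a i; rewrite truncn_lt_nat ?mulr_ge0 //.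
  by rewrite gtr_pMr.
(* Pigeonhole: N^k + 1 multiples of z are distributed over N^k boxes of side 1/N according to their
   fractional parts. *)
pose g (a : 'I_(N ^ k).+1) : {ffun 'I_k -> 'I_N} := [ffun i => Ordinal (trN a i)].
have /injectivePn[a [b ab gab]] : ~~ injectiveb g.
  apply/negP => /injectiveP/leq_card.
  by rewrite card_ffun !card_ord ltnn.
wlog lt_ab : a b ab gab / (a < b)%N.
  move=> W; have [/W||/val_inj E] := ltngtP a b; first exact.
    by move=> /W; apply; rewrite 1?eq_sym.
  by rewrite E eqxx in ab.
exists (b - a)%N, (fun i => fl b i - fl a i); split.
  by rewrite subn_gt0 lt_ab /= (leq_trans (leq_subr _ _)) // -ltnS.
move=> i; have /(congr1 val) /= gi : g a i = g b i by rewrite gab.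
rewrite !ffunE /= in gi.
have bnd c : (Num.truncn (N%:R * fr c i))%:R <= N%:R * fr c i <
    (Num.truncn (N%:R * fr c i))%:R + 1.
  have /andP[f0 f1] := fr01 c i.
  by rewrite natr1; apply: truncn_itv; rewrite mulr_ge0.
have /andP[a1 a2] := bnd a; have /andP[b1 b2] := bnd b; rewrite -gi in b1 b2.
have -> : z i * (b - a)%:R - (fl b i - fl a i)%:~R = fr b i - fr a i.
  by rewrite natrB 1?ltnW // rmorphB /= /fr; ring.
rewrite -(ler_pM2l NR0) divff ?gt_eqF // -{1}(gtr0_norm NR0) -normrM mulrBr.
by rewrite ler_norml; apply/andP; split; lra.
Qed.

Lemma lambda_hat_vec1_ge (R : realType) (k : nat) (z : 'I_k -> R) : (0 < k)%N ->
  ((k%:R^-1)%:E <= lambda_hat_vec z 1)%E.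
Proof.
move=> k0; apply: lee_ereal_sup_EFin => eta eta_lt.
have kR0 : 0 < k%:R :> R by rewrite ltr0n.
have kV0 : 0 < k%:R^-1 :> R by rewrite invr_gt0.
have s0 : 0 < k%:R^-1 - eta by rewrite subr_gt0.
(* With N the integer part of X^(1/k), [B1] gives N > 1 and [B2] gives 2 X^eta < X^(1/k) < N + 1;
   together X^eta < N. *)
have [B1 hB1] := powR_gt_near 2 kV0; have [B2 hB2] := powR_gt_near 2 s0.
exists (Num.max 1 (Num.max B1 B2)) => X; rewrite !ge_max => /and3P[X1 /hB1 {}hB1 /hB2 {}hB2].
have X0 : 0 < X by apply: lt_le_trans X1.
have Xe0 : 0 < X `^ eta by apply: powR_gt0.
set N := Num.truncn (X `^ k%:R^-1).
have /andP[N1 N2] : N%:R <= X `^ k%:R^-1 < N%:R + 1.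
  by rewrite natr1; apply: truncn_itv; apply: powR_ge0.
have XE : X `^ k%:R^-1 = X `^ (k%:R^-1 - eta) * X `^ eta.
  by rewrite -powRD ?subrK //; apply/implyP => _; rewrite gt_eqF.
have N_gt : X `^ eta < N%:R.
  have : 2 * X `^ eta < X `^ k%:R^-1 by rewrite XE ltr_pM2r.
  lra.
have NR0 : 0 < N%:R :> R by apply: lt_trans N_gt.
have [|x [y [/andP[x0 xN] hxy]]] := @dirichlet_simultaneous _ k N z.
  by rewrite -(@ltr0n R).
have xX : x%:R <= X.
  have -> : X = (X `^ k%:R^-1) ^+ k.
    by rewrite -powR_mulrn ?powR_ge0 // -powRrM mulVf ?gt_eqF // powRr1 // ltW.
  apply: (@le_trans _ _ (N%:R ^+ k)); first by rewrite -natrX ler_nat.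
  by apply: lerXn2r; rewrite ?nnegrE ?powR_ge0.
exists (\row_c if unlift ord0 c is Some i then y i else x%:Z); split.
  rewrite -row_leq_rank lt0n mxrank_eq0; apply/eqP => /matrixP/(_ ord0 ord0).
  by rewrite !mxE unlift_none => /eqP; rewrite intr_eq0 eqz_nat gtn_eqF.
move=> r; split; rewrite !mxE unlift_none; first by rewrite normr_nat.
move=> i; rewrite mxE liftK; apply: (le_trans (hxy i)).
by rewrite powRN lef_pV2 ?posrE // ltW.
Qed.

Lemma lambda_hat_vec_ge0 (R : realType) (k j : nat) (z : 'I_k -> R) :
  (j <= k.+1)%N -> (0%:E <= lambda_hat_vec z j)%E.
Proof.
(* For eta = 0 errors up to 1 are allowed, and X >= 1 admits x = 1. *)
move=> jk; apply: ereal_sup_ubound; exists 0 => //; exists 1 => X X1.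
apply: (has_indep_sols_le jk).
pose first_row c : int := if unlift ord0 c is Some i then Num.floor (z i) else 1.
exists (\matrix_(m, c) if m == ord0 then first_row c else (m == c)%:R); split.
  (* The matrix is upper triangular with unit diagonal; transposing it matches the lower triangular
     form of [det_trig]. *)
  rewrite row_free_unit unitmxE unitfE -det_tr det_trig; last first.
    apply/is_trig_mxP => c m cm; rewrite !mxE.
    have /negPf -> : m != ord0 by apply: contraTneq cm => ->.
    by rewrite -val_eqE /= gtn_eqF.
  rewrite big1 ?oner_eq0 // => m _; rewrite !mxE eqxx.
  by case: eqP => // ->; rewrite /first_row unlift_none.
move=> m; split; rewrite ?mxE.
  have [_|m0] := eqVneq m ord0; first by rewrite /first_row unlift_none normr1.
  by rewrite normr0 (le_trans _ X1).
move=> i; rewrite !mxE oppr0 powRr0.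
have [_|m0] := eqVneq m ord0.
  rewrite /first_row unlift_none liftK mulr1 ger0_norm ?subr_ge0 ?floor_le //.
  by have := floorD1_gt (z i); rewrite rmorphD /=; lra.
by rewrite mulr0 sub0r normrN; case: eqP; rewrite ?normr1 ?normr0.
Qed.

Unset Implicit Arguments.

Theorem theorem6 (R : realType) (zeta : R) (Hz : liouville zeta) (k : nat)
  (Hk : (0 < k)%N) :
  lambda k 1 zeta = +oo%E /\
  (forall j : nat, (2 <= j <= k.+1)%N ->
     ((k%:R)^-1%:E <= lambda k j zeta)%E /\
     (lambda k j zeta <= ((j.-1)%:R)^-1%:E)%E) /\
  lambda_hat k 1 zeta = ((k%:R)^-1)%:E /\
  (forall j : nat, (2 <= j <= k.+1)%N -> lambda_hat k j zeta = 0%:E).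
Proof.
split; first exact: lambda1_eq.
split.
  case=> [//|j] /andP[j0 jk]; split; first exact: lambda_ge.
  exact: lambda_vec_le.
split; first by apply/eqP; rewrite eq_le lambda_hat1_le //= lambda_hat_vec1_ge.
move=> j /andP[j1 jk]; apply/eqP; rewrite eq_le lambda_hat_le0 //=.
exact: lambda_hat_vec_ge0.
Qed.
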